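(* Let $n$ and $k$ be integers with $2 \le k < n$. Then the $(n,k)$ batch mix is stable, i.e., its state process $L(t)$ is positive recurrent (equivalently, it admits an invariant probability measure).
   Context: An $(n,k)$ batch mix (with integers $n \ge 2$, $2 \le k \le n$) is a system of $n$ first-in first-out queues with infinite buffers, where queue $i$ receives messages from its own sender according to a Poisson process of rate $\lambda>0$, the $n$ arrival processes being independent. Messages are held (blocked) as long as fewer than $k$ queues are non-empty; as soon as $k$ queues become non-empty (which happens at an arrival instant, the arriving message counting as present), one message is removed from the head of each of these $k$ non-empty queues and dispatched instantly. Hence at any time at most $k-1$ queues are non-empty. No transmission or reception delays are modeled. The state of the system is the continuous-time Markov process $L(t) = (l_1(t), \dots, l_{k-1}(t))$, where $l_i(t)$ is the length of the $i$-th longest queue at time $t$. Stability means existence of an invariant probability measure for $L(t)$. *)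

(* Defs.v *)
From HB Require Import structures.
From mathcomp Require Import all_boot all_order all_algebra.
From mathcomp Require Import all_classical all_reals all_analysis.
Set Implicit Arguments. Unset Strict Implicit. Unset Printing Implicit Defensive.
Import Order.TTheory GRing.Theory Num.Theory.

(* States of the (n,k) batch mix: L = (l_1,...,l_{k-1}), the lengths of the
   k-1 longest queues, in nonincreasing order (zeros for empty queues). *)
Definition bm_state (k : nat) (l : seq nat) : bool :=
  (size l == k.-1) && sorted geq l.

Definition bm_nonempty (l : seq nat) : nat := count (fun x => 0 < x) l.

Definition bm_arrival_empty (k : nat) (l : seq nat) : seq nat :=
  if bm_nonempty l < k.-1 then sort geq (set_nth 0%N l (bm_nonempty l) 1%N)
  else map predn l. (* k queues non-empty: one message from each is dispatched *)

(* Jump transitions out of state l, as (rate, target) pairs: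
   - a message arrives at the i-th longest queue, if it is non-empty (rate lam);
   - a message arrives at one of the n - m empty queues (total rate (n-m) lam). *)
Definition bm_trans (R : realType) (n k : nat) (lam : R) (l : seq nat)
  : seq (R * seq nat) :=
  [seq (lam, sort geq (incr_nth l i)) | i <- iota 0 (size l) & 0 < nth 0%N l i]
  ++ [:: ((lam *+ (n - bm_nonempty l))%R, bm_arrival_empty k l)].

Local Open Scope ring_scope.
Local Open Scope classical_set_scope.

Definition bm_rate (R : realType) (n k : nat) (lam : R) (x y : seq nat) : R :=
  \sum_(p <- bm_trans n k lam x | p.2 == y) p.1.

(* Invariant probability measure of the continuous-time Markov chain L(t)
   (bounded rates, hence non-explosive): a probability pi on the state space
   satisfying the global balance equations pi Q = 0. *)
Definition bm_invariant_prob (R : realType) (n k : nat) (lam : R)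
  (pi : seq nat -> R) : Prop :=
  (forall l, bm_state k l -> 0 <= pi l) /\
  (\esum_(l in [set l | bm_state k l]) (pi l)%:E = 1%E) /\
  (forall y, bm_state k y ->
     ((pi y * \sum_(p <- bm_trans n k lam y | p.2 != y) p.1)%:E =
      \esum_(x in [set x | bm_state k x /\ x != y]) (pi x * bm_rate n k lam x y)%:E)).

Definition batch_mix_stable (R : realType) (n k : nat) (lam : R) : Prop :=
  exists pi : seq nat -> R, bm_invariant_prob n k lam pi.

(* Main.v *)
(* Foster's criterion with the Lyapunov function
   V(l) = k * sum l_i^2 - (sum l_i)^2, which is nonnegative by Cauchy-Schwarz
   because l has only k-1 entries. Its drift is exactly
   lam * n * (k-1) - 2 * lam * (n-k) * sum l_i, so that, as k < n, the time
   averages of the total length along the jump chain are bounded. All states are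
   left at the same rate n * lam, hence the balance equations are those of the
   jump chain. Its time-averaged laws are tight and any limit point of them is an
   invariant probability. *)
Require Import Defs.
From mathcomp Require Import all_boot all_order all_algebra.
From mathcomp Require Import all_classical all_reals all_analysis.
From mathcomp Require Import ring lra zify.
Import Order.TTheory GRing.Theory Num.Theory numFieldNormedType.Exports.
Local Open Scope ring_scope.
Local Open Scope classical_set_scope.

(** An ultrafilter converges to each of its cluster points, and compactness of [[-M, M]] supplies
    one. *)
Lemma ultra_bounded_cvg (R : realType) (I : Type) (U : set_system I)
    (UU : UltraFilter U) (u : I -> R) (M : R) :
  (forall i, `|u i| <= M) -> cvg (u @ U).
Proof.
move=> uM.
have /(_ _ _) [] := @segment_compact R (- M) M (u @ U) _.
  by apply: (@filterE _ U) => i; rewrite /= in_itv /= -ler_norml uM.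
move=> l [_ cl]; apply/cvg_ex; exists l => B Bl.
have [//|UB] := in_ultra_setVsetC (u @^-1` B) UU.
by have [x [nBx Bx]] := cl (~` B) B UB Bl.
Qed.

(** * One-step averages of a jump chain with constant exit rate *)

Section Foster.
Context {R : realType} {T : choiceType}.
Variables (D : pred T) (tr : T -> seq (R * T)) (c : R).
Hypothesis c_gt0 : 0 < c.
Hypothesis tr_ge0 : forall x p, D x -> p \in tr x -> 0 <= p.1.
Hypothesis tr_closed : forall x p, D x -> p \in tr x -> D p.2.
Hypothesis tr_total : forall x, D x -> \sum_(p <- tr x) p.1 = c.
Implicit Types (f g h : T -> R) (x y : T).

(** Transition operator of the jump chain, with [p.1 / c] as jump probability. Transitions from [x]
    to itself are kept; they cancel only in the balance equations. *)
Definition jump_mean f x : R := c^-1 * \sum_(p <- tr x) p.1 * f p.2.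

Lemma jump_meanD f g : jump_mean (f \+ g) = jump_mean f \+ jump_mean g.
Proof.
apply/funext => x; rewrite /jump_mean /= -mulrDr -big_split /=.
by congr (_ * _); apply: eq_bigr => p _; rewrite mulrDr.
Qed.

Lemma jump_meanZ (a : R) f : jump_mean (a \*o f) = a \*o jump_mean f.
Proof.
apply/funext => x; rewrite /jump_mean /= [RHS]mulrCA [in RHS]mulr_sumr.
by congr (_ * _); apply: eq_bigr => p _; rewrite mulrCA.
Qed.

Lemma jump_mean_le f g : (forall x, D x -> f x <= g x) ->
  forall x, D x -> jump_mean f x <= jump_mean g x.
Proof.
move=> fg x Dx; rewrite ler_pM2l ?invr_gt0// big_seq [leRHS]big_seq.
apply: ler_sum => p px; apply: ler_wpM2l; first exact: tr_ge0 px.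
by apply: fg; exact: tr_closed px.
Qed.

Lemma jump_mean_cst a x : D x -> jump_mean (cst a) x = a.
Proof. by move=> Dx; rewrite /jump_mean -mulr_suml tr_total// mulKf ?gt_eqF. Qed.

Lemma iter_jump_meanD t f g : iter t jump_mean (f \+ g) =
  iter t jump_mean f \+ iter t jump_mean g.
Proof. by elim: t => //= t ->; rewrite jump_meanD. Qed.

Lemma iter_jump_meanZ t (a : R) f : iter t jump_mean (a \*o f) =
  a \*o iter t jump_mean f.
Proof. by elim: t => //= t ->; rewrite jump_meanZ. Qed.

Lemma iter_jump_mean_le t f g : (forall x, D x -> f x <= g x) ->
  forall x, D x -> iter t jump_mean f x <= iter t jump_mean g x.
Proof. by move=> fg; elim: t => //= t IH; exact: jump_mean_le. Qed.

Lemma iter_jump_mean_cst t a x : D x -> iter t jump_mean (cst a) x = a.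
Proof.
elim: t x => //= t IH x Dx; rewrite -[RHS](@jump_mean_cst a x)//.
by apply/eqP; rewrite eq_le !jump_mean_le// => y Dy; rewrite IH.
Qed.

(** * Time averages from a fixed starting state *)

Variable x0 : T.
Hypothesis Dx0 : D x0.

Definition time_mean f (N : nat) : R :=
  N.+1%:R^-1 * \sum_(t < N.+1) iter t jump_mean f x0.

Lemma time_meanD f g N : time_mean (f \+ g) N = time_mean f N + time_mean g N.
Proof.
rewrite /time_mean -mulrDr -big_split /=.
by congr (_ * _); apply: eq_bigr => t _; rewrite iter_jump_meanD.
Qed.

Lemma time_meanZ a f N : time_mean (a \*o f) N = a * time_mean f N.
Proof.
rewrite /time_mean [RHS]mulrCA [in RHS]mulr_sumr.
by congr (_ * _); apply: eq_bigr => t _; rewrite iter_jump_meanZ.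
Qed.

Lemma time_mean_le f g N : (forall x, D x -> f x <= g x) ->
  time_mean f N <= time_mean g N.
Proof.
move=> fg; rewrite ler_pM2l ?invr_gt0 ?ltr0n//.
by apply: ler_sum => t _; exact: iter_jump_mean_le.
Qed.

Lemma eq_time_mean f g N : (forall x, D x -> f x = g x) ->
  time_mean f N = time_mean g N.
Proof.
by move=> fg; apply/eqP; rewrite eq_le !time_mean_le// => x Dx; rewrite fg.
Qed.

Lemma time_mean_cst a N : time_mean (cst a) N = a.
Proof.
rewrite /time_mean (eq_bigr (fun=> a)) => [|t _]; last by rewrite iter_jump_mean_cst.
by rewrite sumr_const card_ord -[a *+ _]mulr_natl mulKf ?pnatr_eq0.
Qed.

(** Applying one jump shifts the window of times by one, so the two sums differ only in their end
    terms. *)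
Lemma time_mean_jump f N :
  time_mean (jump_mean f) N =
  time_mean f N + N.+1%:R^-1 * (iter N.+1 jump_mean f x0 - f x0).
Proof.
rewrite /time_mean -mulrDr; congr (_ * _).
apply: (addIr (f x0)); rewrite -[RHS]addrA subrK.
transitivity (\sum_(t < N.+2) iter t jump_mean f x0); last by rewrite big_ord_recr.
rewrite [RHS]big_ord_recl addrC; congr (_ + _).
by apply: eq_bigr => t _; rewrite -iterSr.
Qed.

Definition indic y x : R := (x == y)%:R.

(** Linearity for functions of finite support, whose averages reduce to finitely many point
    masses. *)
Lemma time_mean_fsum (s : seq T) f N :
  time_mean (fun x => \sum_(y <- s) f y * indic y x) N =
  \sum_(y <- s) f y * time_mean (indic y) N.
Proof.
elim: s => [|y s IH].
  rewrite big_nil -[RHS](time_mean_cst 0 N).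
  by apply: eq_time_mean => x _; rewrite big_nil.
rewrite big_cons -IH -time_meanZ -time_meanD.
by apply: eq_time_mean => x _; rewrite big_cons.
Qed.

Lemma fsum_indic (s : seq T) f x : uniq s ->
  \sum_(y <- s) f y * indic y x = if x \in s then f x else 0.
Proof.
move=> us; case: ifPn => [xs|xs].
  rewrite (bigD1_seq x)//= /indic eqxx mulr1 big1 ?addr0// => y.
  by rewrite eq_sym => /negbTE ->; rewrite mulr0.
rewrite big_seq big1// => y ys; rewrite /indic.
by case: eqP xs => [->|_]; rewrite ?ys ?mulr0.
Qed.

Lemma time_mean_bounded f a N : (forall x, D x -> 0 <= f x <= a) ->
  0 <= time_mean f N <= a.
Proof.
move=> fa; apply/andP; split.
  by rewrite -[leLHS](time_mean_cst 0 N); apply: time_mean_le => x /fa /andP[].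
by rewrite -[leRHS](time_mean_cst a N); apply: time_mean_le => x /fa /andP[].
Qed.

(** * The drift condition and the bound it gives *)

Variables (V g : T -> R) (b : R).
Hypothesis V_ge0 : forall x, D x -> 0 <= V x.
Hypothesis g_ge0 : forall x, D x -> 0 <= g x.
Hypothesis g_fin : forall M, finite_set [set x | D x /\ g x <= M].
Hypothesis drift : forall x, D x ->
  \sum_(p <- tr x) p.1 * (V p.2 - V x) <= b - g x.

Lemma jump_mean_drift x : D x -> jump_mean V x <= V x + c^-1 * (b - g x).
Proof.
move=> Dx; rewrite -lerBlDl -{1}(@jump_mean_cst (V x) x Dx) /jump_mean -mulrBr.
rewrite ler_pM2l ?invr_gt0// -sumrB; apply: le_trans (drift _ Dx).
by under eq_bigr => p _ do rewrite -mulrBr.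
Qed.

(** Averaging the drift inequality telescopes [V]: the final value is dropped as nonnegative and the
    initial one is divided by [N.+1], hence a bound uniform in [N]. *)
Lemma time_mean_drift N : time_mean g N <= b + c * V x0.
Proof.
have : time_mean (jump_mean V) N <=
    time_mean (V \+ (c^-1 \*o (cst b \+ (-1 \*o g)))) N.
  apply: time_mean_le => x Dx; apply: le_trans (jump_mean_drift _ Dx) _.
  by rewrite /= mulN1r.
rewrite time_mean_jump !(time_meanD, time_meanZ) time_mean_cst lerD2l.
have itV : 0 <= iter N.+1 jump_mean V x0.
  by rewrite -(@iter_jump_mean_cst N.+1 0 x0)//; exact: iter_jump_mean_le.
have V0 := V_ge0 _ Dx0.
have /andP[iN0 iN1] : 0 <= (N.+1%:R^-1 : R) <= 1.
  by rewrite invr_ge0 ler0n invf_le1 ?ltr0n// ler1n.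
rewrite -(ler_pM2l c_gt0) mulVKf ?gt_eqF// mulN1r => le_drift.
rewrite -lerBlDl -lerN2 opprB; apply: le_trans le_drift.
rewrite -mulrN ler_pM2l// mulrBr -[leLHS]add0r.
by apply: lerD; [exact: mulr_ge0|rewrite lerN2 ler_piMl].
Qed.

(** * Limits of time averages along an ultrafilter *)

Variable U : set_system nat.
Context {UU : UltraFilter U}.
Hypothesis Uoo : \oo `<=` U.

(* The ultrafilter makes all the bounded time averages converge at once, in
   place of a diagonal extraction over the states. *)
Definition lim_mean f : R := lim (time_mean f @ U).

Lemma cvg_lim_mean f a : (forall x, D x -> 0 <= f x <= a) ->
  time_mean f @ U --> lim_mean f.
Proof.
move=> fa; apply: (@ultra_bounded_cvg _ _ _ _ _ a) => N.
by have /andP[f0 ?] := time_mean_bounded _ _ N fa; rewrite ger0_norm.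
Qed.

(** Candidate invariant law: the limiting expected fraction of time spent at [y]. *)
Definition lim_mass y := lim_mean (indic y).

Lemma cvg_lim_mass y : time_mean (indic y) @ U --> lim_mass y.
Proof.
by apply: (cvg_lim_mean _ 1) => x _; rewrite /indic; case: eqP; rewrite ?lexx ?ler01.
Qed.

Lemma lim_mass_ge0 y : 0 <= lim_mass y.
Proof.
apply: limr_ge; first by apply/cvg_ex; eexists; exact: cvg_lim_mass.
apply: nearW => N; rewrite -[leLHS](time_mean_cst 0 N).
by apply: time_mean_le => x _; rewrite /indic /=.
Qed.

Lemma cvg_time_mean_fsum (s : seq T) f :
  time_mean (fun x => \sum_(y <- s) f y * indic y x) @ U -->
  \sum_(y <- s) lim_mass y * f y.
Proof.
rewrite (_ : time_mean _ = fun N => \sum_(y <- s) time_mean (indic y) N * f y).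
  apply: cvg_big => [|y _]; first exact: add_continuous.
  by apply: cvgM; [exact: cvg_lim_mass|exact: cvg_cst].
apply/funext => N; rewrite time_mean_fsum.
by apply: eq_bigr => y _; rewrite mulrC.
Qed.

(** Truncating [f] to finite sets bounds the sum by the limit; the converse holds because no mass
    escapes to infinity. *)
Lemma lim_mean_esum f a : (forall x, D x -> 0 <= f x <= a) ->
  (lim_mean f)%:E = \esum_(x in [set x | D x]) (lim_mass x * f x)%:E.
Proof.
move=> fa; apply/eqP; rewrite eq_le; apply/andP; split; last first.
  apply: ge_ereal_sup => _ [X [finX XD]] <-.
  rewrite fsumEFin// lee_fin fsbig_finite//=.
  apply: ler_cvg_to (cvg_time_mean_fsum _ _) (cvg_lim_mean _ _ fa) _.
  apply: nearW => N; apply: time_mean_le => x Dx; rewrite fsum_indic//.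
  by case: ifP => // _; have /andP[] := fa _ Dx.
(* Tightness: Markov's inequality for [g] leaves mass at most [e] outside the
   finite set [X]. *)
apply/lee_addgt0Pr => e e0.
have a_ge0 : 0 <= a by have /andP[/le_trans] := fa _ Dx0; apply.
pose B := b + c * V x0.
have B_ge0 : 0 <= B.
  apply: le_trans (time_mean_drift 0); rewrite -[leLHS](time_mean_cst 0 0).
  exact: time_mean_le.
(* The level is chosen so that [a / M * B <= e]; adding 1 to both factors keeps [M] positive. *)
pose M := (a + 1) * (B + 1) / e.
have M0 : 0 < M by rewrite divr_gt0// mulr_gt0// ltr_wpDl.
pose X := [set x | D x /\ g x <= M].
have finX : finite_set X by exact: g_fin.
apply: (@le_trans _ _ ((\sum_(x \in X) (lim_mass x * f x)%:E) + e%:E)); last first.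
  apply: leeD => //; apply: esum_ge; exists X => //.
  by split => // x [].
rewrite fsumEFin// -EFinD lee_fin fsbig_finite//=.
apply: ler_cvg_to (cvg_lim_mean _ _ fa) (cvgD (cvg_time_mean_fsum _ _) (cvg_cst e)) _.
apply: nearW => N; rewrite -[leRHS]/(time_mean _ N + e).
(* Off [X], [f <= a] and [g > M], so [a / M * g] dominates [f] there. *)
have f_le : time_mean f N <=
    time_mean ((fun x => \sum_(y <- finmap.enum_fset (fset_set X))
                           f y * indic y x) \+ (a / M \*o g)) N.
  apply: time_mean_le => x Dx /=; rewrite fsum_indic// in_fset_set//.
  have /andP[fx0 fxa] := fa _ Dx; have gx0 := g_ge0 _ Dx.
  case: ifPn => [_|]; first by rewrite lerDl mulr_ge0// divr_ge0// ltW.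
  rewrite notin_setE /X /= => /not_andP[//|/negP]; rewrite -ltNge add0r => Mg.
  apply: le_trans fxa _; rewrite -mulrA ler_peMr//.
  by rewrite mulrC ler_pdivlMr// mul1r ltW.
apply: le_trans f_le _; rewrite time_meanD time_meanZ lerD2l.
apply: (@le_trans _ _ (a / M * B)).
  by apply: ler_wpM2l; [rewrite divr_ge0// ltW|exact: time_mean_drift].
rewrite mulrAC ler_pdivrMr// /M mulrCA mulfV ?gt_eqF// mulr1.
by apply: ler_pM; rewrite // lerDl.
Qed.

(** The end terms left by the shift lie between 0 and [a], so dividing their difference by [N.+1]
    makes it vanish along [U], which refines [\oo]. *)
Lemma time_mean_jump_cvg f a : (forall x, D x -> 0 <= f x <= a) ->
  time_mean (jump_mean f) @ U --> lim_mean f.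
Proof.
move=> fa; rewrite (_ : time_mean _ = fun N => time_mean f N +
    harmonic N * (iter N.+1 jump_mean f x0 - f x0)); last first.
  by apply/funext => N; rewrite time_mean_jump.
rewrite -[lim_mean f]addr0; apply: cvgD; first exact: cvg_lim_mean fa.
have cvg_a : (fun N => harmonic N * a) @ U --> (0 : R).
  rewrite -(mul0r a); apply: cvgM; last exact: cvg_cst.
  by apply: cvg_trans cvg_harmonic; exact: cvg_app.
apply: norm_cvg0; apply: squeeze_cvgr (cvg_cst 0) cvg_a.
apply: nearW => N; rewrite normr_ge0 normrM (ger0_norm (harmonic_ge0 _))/=.
apply: ler_wpM2l; first exact: harmonic_ge0.
have /andP[f0 fa0] := fa _ Dx0.
have it0 : 0 <= iter N.+1 jump_mean f x0.
  rewrite -[leLHS](iter_jump_mean_cst N.+1 0 x0 Dx0).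
  by apply: iter_jump_mean_le => // x /fa /andP[].
have ita : iter N.+1 jump_mean f x0 <= a.
  rewrite -[leRHS](iter_jump_mean_cst N.+1 a x0 Dx0).
  by apply: iter_jump_mean_le => // x /fa /andP[].
rewrite /= in it0 ita; rewrite ler_norml; apply/andP; split; lra.
Qed.

(** * Total mass and balance equations of the limit law *)

Lemma lim_mass_total : \esum_(x in [set x | D x]) (lim_mass x)%:E = 1%E.
Proof.
under eq_esum => x _ do rewrite -[lim_mass x]mulr1.
rewrite -(lim_mean_esum (cst 1) 1) => [|x _]; last by rewrite ler01 lexx.
congr EFin; apply: cvg_lim => //.
rewrite (_ : time_mean _ = cst 1); first exact: cvg_cst.
by apply/funext => N; exact: time_mean_cst.
Qed.

(** The limit of the mean rate of jumps into [y] from other states is computed twice: as a sum over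
    the sources, and, since one more jump does not change the limit, as [c - rate y] times the mass
    of [y], which is the outflow. *)
Lemma lim_mass_balance y : D y ->
  ((lim_mass y * \sum_(p <- tr y | p.2 != y) p.1)%:E =
   \esum_(x in [set x | D x /\ x != y])
     (lim_mass x * \sum_(p <- tr x | p.2 == y) p.1)%:E).
Proof.
move=> Dy; pose rate x := \sum_(p <- tr x | p.2 == y) p.1.
pose f x := if x != y then rate x else 0.
have rate_ge0 x : D x -> 0 <= rate x.
  move=> Dx; rewrite /rate big_seq_cond sumr_ge0// => p /andP[px _].
  exact: tr_ge0 px.
have rateD x : D x -> rate x + \sum_(p <- tr x | p.2 != y) p.1 = c.
  by move=> Dx; rewrite -(tr_total _ Dx) [RHS](bigID (fun p => p.2 == y)).
have fc x : D x -> 0 <= f x <= c.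
  move=> Dx; rewrite /f; case: ifP => _; last by rewrite lexx ltW.
  rewrite rate_ge0//= -(rateD _ Dx) lerDl big_seq_cond sumr_ge0// => p.
  by move=> /andP[px _]; exact: tr_ge0 px.
transitivity (lim_mean f)%:E; last first.
  rewrite (lim_mean_esum _ _ fc) esum_mkcondr.
  apply: eq_esum => x Dx; rewrite /f /mkset.
  case: ifPn => [xy|xy]; first by rewrite mem_set.
  by rewrite mulr0 memNset//; exact/negP.
congr EFin; apply/esym/cvg_lim => //.
(* On [D], [f] is the rate of all jumps into [y], less those from [y] to itself. *)
rewrite (_ : time_mean f = fun N => c * time_mean (jump_mean (indic y)) N
                                 - rate y * time_mean (indic y) N); last first.
  apply/funext => N; rewrite -mulNr -!time_meanZ -time_meanD.
  apply: eq_time_mean => x Dx /=; rewrite /jump_mean mulVKf ?gt_eqF//.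
  rewrite (_ : \sum_(p <- tr x) _ = rate x).
    rewrite /f /indic; case: eqP => [->|_] /=.
      by rewrite mulr1 subrr.
    by rewrite mulr0 addr0.
  rewrite /rate [in RHS]big_mkcond /=; apply: eq_bigr => p _; rewrite /indic.
  by case: eqP; rewrite ?mulr1 ?mulr0.
rewrite (_ : _ * _ = c * lim_mass y - rate y * lim_mass y); last first.
  by rewrite -mulrBl -(rateD _ Dy) addrAC subrr add0r mulrC.
apply: cvgB; apply: cvgM; try exact: cvg_cst; last exact: cvg_lim_mass.
by apply: (time_mean_jump_cvg _ 1) => x _; rewrite /indic; case: eqP;
  rewrite ?lexx ?ler01.
Qed.

End Foster.

Lemma foster_invariant (R : realType) (T : choiceType) (D : pred T)
    (tr : T -> seq (R * T)) (c : R) (V g : T -> R) (b : R) (x0 : T) :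
  0 < c ->
  (forall x p, D x -> p \in tr x -> 0 <= p.1) ->
  (forall x p, D x -> p \in tr x -> D p.2) ->
  (forall x, D x -> \sum_(p <- tr x) p.1 = c) ->
  D x0 ->
  (forall x, D x -> 0 <= V x) ->
  (forall x, D x -> 0 <= g x) ->
  (forall M, finite_set [set x | D x /\ g x <= M]) ->
  (forall x, D x -> \sum_(p <- tr x) p.1 * (V p.2 - V x) <= b - g x) ->
  exists pi : T -> R,
    (forall x, D x -> 0 <= pi x) /\
    \esum_(x in [set x | D x]) (pi x)%:E = 1%E /\
    (forall y, D y ->
      (pi y * \sum_(p <- tr y | p.2 != y) p.1)%:E =
      \esum_(x in [set x | D x /\ x != y])
        (pi x * \sum_(p <- tr x | p.2 == y) p.1)%:E).
Proof.
move=> c0 tr0 trD trc Dx0 V0 g0 gfin dr.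
(* An ultrafilter refining [\oo] is fixed; its limit masses form the invariant law. *)
have [U [UU Uoo]] := @ultraFilterLemma nat \oo _.
exists (lim_mass tr c x0 U); split; [|split].
- by move=> x _; exact: (lim_mass_ge0 D tr c c0 tr0 trD trc x0 Dx0 U).
- exact: (lim_mass_total D tr c c0 tr0 trD trc x0 Dx0 V g b V0 g0 gfin dr U).
- exact: (lim_mass_balance D tr c c0 tr0 trD trc x0 Dx0 V g b V0 g0 gfin dr U Uoo).
Qed.

(** * Facts on lists of queue lengths *)

Lemma bm_state_sort k (s : seq nat) : size s = k.-1 -> bm_state k (sort geq s).
Proof.
by move=> ss; rewrite /bm_state size_sort ss eqxx; apply: sort_sorted (fun x y => leq_total y x) _.
Qed.

Lemma big_set_nth {R : zmodType} (F : nat -> R) (l : seq nat) i y :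
  (i < size l)%N ->
  \sum_(x <- set_nth 0%N l i y) F x =
  \sum_(x <- l) F x + (F y - F (nth 0%N l i)).
Proof.
elim: l i => // a l IH [_|i il] /=; rewrite !big_cons.
  by rewrite [RHS]addrC addrA subrK.
by rewrite IH// addrA.
Qed.

Lemma incr_nthE (l : seq nat) i : (i < size l)%N ->
  incr_nth l i = set_nth 0%N l i (nth 0%N l i).+1.
Proof. by elim: l i => // a l IH [//|i] /= il; rewrite IH. Qed.

(** In a nonincreasing list the zeros come last, so the number of positive entries is the index of
    the first zero; if there is none, [nth] returns its default 0. *)
Lemma nth_bm_nonempty (l : seq nat) :
  sorted geq l -> nth 0%N l (bm_nonempty l) = 0%N.
Proof.
elim: l => //= a l IH pl; have sl := path_sorted pl.
rewrite /bm_nonempty /=; case: a pl => [|a] pl /=; last exact: IH.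
rewrite add0n; suff /all_pred1P -> : all (pred1 0%N) l.
  by rewrite count_nseq.
have := order_path_min (rev_trans leq_trans) pl.
by apply: sub_all => x /=; rewrite leqn0.
Qed.

(** Cauchy-Schwarz against the constant 1; the induction step uses that the sum of the
    [(a - x) ^+ 2] is nonnegative. *)
Lemma sqr_sum_le {R : realDomainType} (s : seq R) :
  (\sum_(x <- s) x) ^+ 2 <= (size s)%:R * \sum_(x <- s) x ^+ 2.
Proof.
elim: s => [|a s IH]; first by rewrite !big_nil expr0n mulr0.
rewrite !big_cons /= -natr1.
have : 0 <= \sum_(x <- s) (a - x) ^+ 2 by apply: sumr_ge0 => x _; exact: sqr_ge0.
rewrite (eq_bigr (fun x => a ^+ 2 + (- (2 * a) * x + x ^+ 2))) => [|x _]; last ring.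
rewrite !big_split /= big_const_seq count_predT iter_addr_0.
rewrite -[_ *+ size s]mulr_natl -[X in _ + (X + _)]mulr_sumr.
move: IH; set S := \sum_(x <- s) x; set Q := \sum_(x <- s) _; set m := _%:R; nra.
Qed.

Lemma finite_seq_bounded j N :
  finite_set [set l : seq nat | size l = j /\ all (geq N) l].
Proof.
(* Such lists are images of tuples over a finite ordinal type. *)
pose f (t : j.-tuple 'I_N.+1) := [seq val i | i <- t].
apply: (@sub_finite_set _ _ [set f t | t in setT]); last first.
  by apply: finite_image; exact: finite_finset.
move=> l [sl /allP lN].
have sz : size [seq inord i : 'I_N.+1 | i <- l] == j by rewrite size_map sl.
exists (Tuple sz) => //; rewrite /f /= -map_comp -[RHS]map_id.
by apply/eq_in_map => x /lN xN /=; rewrite inordK.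
Qed.

(** * Drift of the quadratic Lyapunov function *)

Section BatchMix.
Variables (R : realType) (n k : nat) (lam : R).
Hypotheses (k_ge2 : (2 <= k)%N) (kn : (k < n)%N) (lam_gt0 : 0 < lam).

Definition msum (l : seq nat) : R := \sum_(x <- l) x%:R.
Definition msumsq (l : seq nat) : R := \sum_(x <- l) x%:R ^+ 2.
(* The weights [k] and [1] make the drift the same affine function of the total
   length whether or not fewer than [k-1] queues are non-empty. *)
Definition lyap (l : seq nat) : R := k%:R * msumsq l - msum l ^+ 2.

Lemma perm_lyap s t : perm_eq s t -> lyap s = lyap t.
Proof. by move=> st; rewrite /lyap /msumsq /msum !(perm_big _ st). Qed.

Lemma lyap_ge0 l : bm_state k l -> 0 <= lyap l.
Proof.
move=> /andP[/eqP sl _].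
have := sqr_sum_le [seq x%:R : R | x <- l]; rewrite size_map sl !big_map.
rewrite -/(msum l) -/(msumsq l) /lyap subr_ge0 => /le_trans; apply.
apply: ler_wpM2r; first by apply: sumr_ge0 => x _; exact: sqr_ge0.
by rewrite ler_nat leq_pred.
Qed.

Lemma lyap_set_nth l i y : (i < size l)%N ->
  lyap (set_nth 0%N l i y) - lyap l =
  k%:R * (y%:R ^+ 2 - (nth 0%N l i)%:R ^+ 2)
  - (2 * msum l * (y%:R - (nth 0%N l i)%:R) + (y%:R - (nth 0%N l i)%:R) ^+ 2).
Proof. by move=> il; rewrite /lyap /msumsq /msum !big_set_nth//; ring. Qed.

(** Also serves for an arrival at an empty queue, whose entry is 0. *)
Lemma lyap_arrival l i : (i < size l)%N ->
  lyap (set_nth 0%N l i (nth 0%N l i).+1) - lyap l =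
  2 * k%:R * (nth 0%N l i)%:R + k%:R - 2 * msum l - 1.
Proof. by move=> il; rewrite lyap_set_nth// -natr1; ring. Qed.

(** Since all entries are positive, [predn] subtracts 1 exactly, and both power sums change by
    explicit amounts. *)
Lemma lyap_dispatch l : all (leq 1) l ->
  lyap (map predn l) - lyap l =
  k%:R * ((size l)%:R - 2 * msum l) + 2 * msum l * (size l)%:R - (size l)%:R ^+ 2.
Proof.
move=> l_gt0.
have pred_nat (x : nat) : (0 < x)%N -> x.-1%:R = x%:R - 1 :> R.
  by move=> x0; rewrite -[in RHS](prednK x0) -natr1 addrK.
have sum1 : \sum_(x <- l) (1 : R) = (size l)%:R.
  by rewrite big_const_seq count_predT iter_addr_0.
rewrite /lyap /msumsq /msum !big_map.
have -> : \sum_(x <- l) x.-1%:R = msum l - (size l)%:R :> R.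
  rewrite -sum1 -sumrB big_seq [RHS]big_seq; apply: eq_bigr => x xl.
  by rewrite pred_nat// (allP l_gt0).
have -> : \sum_(x <- l) x.-1%:R ^+ 2 = msumsq l - 2 * msum l + (size l)%:R :> R.
  rewrite -sum1 mulr_sumr -sumrB -big_split big_seq [RHS]big_seq /=.
  apply: eq_bigr => x xl.
  by rewrite pred_nat ?(allP l_gt0)//; ring.
rewrite -/(msum l) -/(msumsq l); ring.
Qed.

Lemma bm_trans_ge0 l p : p \in bm_trans n k lam l -> 0 <= p.1.
Proof.
rewrite mem_cat => /orP[/mapP[i _ ->]|]; first exact: ltW.
by rewrite inE => /eqP ->; rewrite mulrn_wge0// ltW.
Qed.

Lemma bm_trans_state l p :
  bm_state k l -> p \in bm_trans n k lam l -> bm_state k p.2.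
Proof.
move=> /andP[/eqP sl sorted_l]; rewrite mem_cat => /orP[/mapP[i]|].
  rewrite mem_filter mem_iota => /andP[_ /= il] -> /=; apply: bm_state_sort.
  by rewrite size_incr_nth il.
rewrite inE => /eqP -> /=; rewrite /bm_arrival_empty; case: ifP => m_lt.
  by apply: bm_state_sort; rewrite size_set_nth sl; apply/maxn_idPr.
rewrite /bm_state size_map sl eqxx /=.
apply: homo_sorted sorted_l => x y; rewrite /= -!subn1; exact: leq_sub2r.
Qed.

(** Arrivals are indexed by position, but only the length found there matters for the drift. *)
Lemma sum_arrivals_nonempty (l : seq nat) (F : nat -> R) :
  \sum_(i <- iota 0 (size l) | (0 < nth 0%N l i)%N) F (nth 0%N l i) =
  \sum_(x <- l | (0 < x)%N) F x.
Proof. by rewrite [RHS](big_nth 0%N) /index_iota subn0. Qed.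

Lemma bm_nonempty_le l : bm_state k l -> (bm_nonempty l <= k.-1)%N.
Proof. by move=> /andP[/eqP <- _]; exact: count_size. Qed.

(** With [m] non-empty queues the rates add up to [m + (n - m)] times [lam]; the subtraction is not
    truncated, as [m <= k.-1 < n]. *)
Lemma bm_trans_total l : bm_state k l ->
  \sum_(p <- bm_trans n k lam l) p.1 = n%:R * lam.
Proof.
move=> /bm_nonempty_le m_le; rewrite /bm_trans big_cat big_map big_filter /=.
rewrite (sum_arrivals_nonempty l (fun=> lam)) big_const_seq iter_addr_0 big_seq1.
by rewrite /= -mulrnDr -/(bm_nonempty l) subnKC ?mulr_natl//; lia.
Qed.

(** With [S = msum l], an arrival at an empty queue changes [lyap] by [k - 1 - 2 * S] whether the
    message is stored or triggers a dispatch, so both cases give the same formula. *)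
Lemma bm_drift l : bm_state k l ->
  \sum_(p <- bm_trans n k lam l) p.1 * (lyap p.2 - lyap l) =
  lam * (n * k.-1)%:R - 2 * lam * (n - k)%:R * msum l.
Proof.
move=> Dl; have m_le := bm_nonempty_le _ Dl.
have /andP[/eqP sl sorted_l] := Dl.
set m := bm_nonempty l in m_le *.
rewrite /bm_trans big_cat big_map big_filter big_seq1 /= -/m.
have -> : \sum_(i <- iota 0 (size l) | (0 < nth 0%N l i)%N)
    lam * (lyap (sort geq (incr_nth l i)) - lyap l) =
    lam * (2 * k%:R * msum l + m%:R * (k%:R - 2 * msum l - 1)).
  pose F (x : nat) := lam * (2 * k%:R * x%:R + (k%:R - 2 * msum l - 1)).
  transitivity (\sum_(x <- l | (0 < x)%N) F x).
    rewrite -sum_arrivals_nonempty big_seq_cond [RHS]big_seq_cond.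
    apply: eq_bigr => i /andP[]; rewrite mem_iota => /andP[_ /= il] _.
    rewrite (perm_lyap _ _ (permEl (perm_sort _ _))) incr_nthE// lyap_arrival// /F.
    by ring.
  rewrite /F -mulr_sumr big_split /= -mulr_sumr; congr (_ * (_ * _ + _)).
    rewrite /msum [RHS](bigID (fun x => (0 < x)%N)) /= [X in _ = _ + X]big1 ?addr0//.
    by move=> x; rewrite -eqn0Ngt => /eqP ->.
  by rewrite big_const_seq iter_addr_0 [RHS]mulr_natl.
have n_sub j : (j <= n)%N -> (n - j)%:R = n%:R - j%:R :> R by exact: natrB.
have k1 : k.-1%:R = k%:R - 1 :> R by rewrite -subn1 natrB//; lia.
rewrite /bm_arrival_empty -/m -[lam *+ _]mulr_natl natrM !n_sub ?k1; [|lia..].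
case: ifPn => [m_lt|]; last first.
  (* All [k.-1] entries are then positive, as the dispatch formula requires. *)
  rewrite -leqNgt => m_ge; have mk : m = k.-1 by lia.
  rewrite lyap_dispatch; last by rewrite all_count sl -mk.
  by rewrite sl mk k1; ring.
rewrite (perm_lyap _ _ (permEl (perm_sort _ _))).
have ml : (m < size l)%N by rewrite sl.
have nth_m : nth 0%N l m = 0%N by exact: nth_bm_nonempty.
have := lyap_arrival _ _ ml; rewrite nth_m => ->; ring.
Qed.

(** Each entry is at most the total, hence at most [M / a], and the number of entries is fixed. *)
Lemma finite_msum_le (a M : R) : 0 < a ->
  finite_set [set l | bm_state k l /\ a * msum l <= M].
Proof.
move=> a0; apply: sub_finite_set (finite_seq_bounded k.-1 (Num.truncn (M / a))).
move=> l [/andP[/eqP sl _] lM]; split => //; apply/allP => x xl /=.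
have xM : x%:R <= M / a.
  rewrite ler_pdivlMr// mulrC; apply: le_trans lM; rewrite ler_pM2l//.
  by rewrite /msum (big_rem _ xl) /= lerDl sumr_ge0.
rewrite -ltnS -(ltr_nat R); apply: le_lt_trans xM _.
by rewrite truncnS_gt.
Qed.

End BatchMix.

(** * Stability, with the chain started from empty queues *)

Lemma bm_state_nseq0 k : bm_state k (nseq k.-1 0%N).
Proof.
by rewrite /bm_state size_nseq eqxx; elim: k.-1 => // -[|j] //= ->.
Qed.

Theorem theorem2 (R : realType) (n k : nat) (lam : R) :
  (2 <= k)%N -> (k < n)%N -> 0 < lam -> batch_mix_stable n k lam.
Proof.
move=> k_ge2 kn lam_gt0.
(* By [k < n] the drift decreases strictly with the total length, so its linear term can serve as
   the [g] of the Foster criterion. *)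
have a_gt0 : 0 < 2 * lam * (n - k)%:R by rewrite !mulr_gt0// ltr0n subn_gt0.
apply: (@foster_invariant R (seq nat) (bm_state k) (bm_trans n k lam) (n%:R * lam)
  (lyap R k) (fun l => 2 * lam * (n - k)%:R * msum R l) (lam * (n * k.-1)%:R)
  (nseq k.-1 0%N)).
- by rewrite mulr_gt0// ltr0n; lia.
- by move=> l p _; exact: bm_trans_ge0.
- by move=> l p; exact: bm_trans_state.
- by move=> l; exact: bm_trans_total.
- exact: bm_state_nseq0.
- by move=> l; exact: lyap_ge0.
- by move=> l _; apply: mulr_ge0; [exact: ltW|exact: sumr_ge0].
- by move=> M; exact: finite_msum_le.
- by move=> l Dl; rewrite bm_drift.
Qed.
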